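(* Let $n\equiv 3\pmod 6$, $n=3m$. The Bose Steiner triple system of order $n$, in which the blocks are labeled from $0$ to $n(n-1)/6-1$ in the order: $B_x$, $x=m-1,m-2,\ldots,0$, followed by $B_{x,y,i}$, $y=1,2,\ldots,m-1$, $x=0,1,\ldots,y-1$, $i=0,1,2$ ($y$ being the outermost and $i$ the innermost index), has dual min-sum equal to $$f_{BYXI}(n)=\begin{cases}\dfrac{55}{1728}n^3+\dfrac{1}{192}n^2-\dfrac{9}{64}n-\dfrac{31}{64}, & \text{if } n/3\equiv 1\pmod 4,\ n\ge 27,\\[2mm] \dfrac{55}{1728}n^3+\dfrac{1}{192}n^2-\dfrac{13}{64}n+\dfrac{13}{64}, & \text{if } n/3\equiv 3\pmod 4,\ n\ge 33.\end{cases}$$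
   Context: For integers $a\le b$, $[a,b]=\{a,\ldots,b\}$. Bose Steiner triple system of order $n=3m$, $m\ge3$ odd: for $x,y\in[0,m-1]$ let $x\oplus_b y\in[0,m-1]$ be the residue of $\frac{m+1}{2}(x+y)$ modulo $m$. The point set is $\{(x,i): x\in[0,m-1],\ i\in[0,2]\}$, and the blocks are $B_x=\{(x,0),(x,1),(x,2)\}$ for $x\in[0,m-1]$, and $B_{x,y,i}=\{(x,i),(y,i),(x\oplus_b y,\ i+1 \bmod 3)\}$ for $0\le x<y\le m-1$, $i\in[0,2]$. There are $n(n-1)/6$ blocks. Given a bijective labeling of the blocks by $0,1,\ldots,n(n-1)/6-1$, the dual min-sum is the minimum, over all points $p$, of the sum of the labels of all blocks containing $p$. *)

(* Defs.v *)
From mathcomp Require Import all_boot all_order all_algebra zify.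
Set Implicit Arguments.
Unset Strict Implicit.
Unset Printing Implicit Defensive.

(* Labelings of the block set [Bs] by 0, ..., #|Bs| - 1; an injection between
   finite sets of equal cardinality is a bijection. *)
Definition block_labeling (T : finType) (Bs : {set {set T}})
    (lab : {set T} -> nat) : Prop :=
  {in Bs &, injective lab} /\ {in Bs, forall B, lab B < #|Bs|}.

Definition point_sum (T : finType) (Bs : {set {set T}})
    (lab : {set T} -> nat) (p : T) : nat :=
  \sum_(B in Bs | p \in B) lab B.

(* The default value of the iterated minimum is the sum of all labels, which
   bounds every point sum from above, so it is harmless as soon as [T] is
   inhabited. *)
Definition dual_min_sum (T : finType) (Bs : {set {set T}})
    (lab : {set T} -> nat) : nat :=
  \big[minn/(\sum_(B in Bs) lab B)]_(p : T) point_sum Bs lab p.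

Lemma point_sum_le (T : finType) (Bs : {set {set T}}) lab (p : T) :
  point_sum Bs lab p <= \sum_(B in Bs) lab B.
Proof. by rewrite (bigID (fun B : {set T} => p \in B) (mem Bs)) leq_addr. Qed.

Lemma dual_min_sumP (T : finType) (Bs : {set {set T}}) lab (p0 : T) :
  (exists p, dual_min_sum Bs lab = point_sum Bs lab p) /\
  (forall p, dual_min_sum Bs lab <= point_sum Bs lab p).
Proof.
have [q _ qmin] := @arg_minnP T p0 xpredT (point_sum Bs lab) isT.
suff dE : dual_min_sum Bs lab = point_sum Bs lab q.
  by rewrite dE; split=> [|p]; [exists q | exact: qmin].
apply/eqP; rewrite eqn_leq; apply/andP; split.
  rewrite /dual_min_sum; elim: (index_enum T) (mem_index_enum q) => //= p s IH.
  rewrite inE big_cons geq_min => /orP[/eqP->|/IH->]; first by rewrite leqnn.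
  by rewrite orbT.
rewrite /dual_min_sum; elim/big_ind: _ => [|a b ha hb|p _]; last exact: qmin.
  exact: point_sum_le.
by rewrite leq_min ha hb.
Qed.

Definition bose_op (m : nat) (x y : 'I_m) : 'I_m :=
  Ordinal (ltn_pmod (m.+1 %/ 2 * (x + y)) (leq_ltn_trans (leq0n x) (ltn_ord x))).

Definition bose_point (m : nat) : finType := ('I_m * 'I_3)%type.

Definition bose_B1 (m : nat) (x : 'I_m) : {set bose_point m} :=
  [set (x, inord 0); (x, inord 1); (x, inord 2)].

(* [ordS i] is i + 1 mod 3. *)
Definition bose_B3 (m : nat) (x y : 'I_m) (i : 'I_3) : {set bose_point m} :=
  [set (x, i); (y, i); (bose_op x y, ordS i)].

Definition bose_blocks (m : nat) : {set {set bose_point m}} :=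
  [set bose_B1 x | x : 'I_m]
    :|: [set bose_B3 t.1.1 t.1.2 t.2 | t : 'I_m * 'I_m * 'I_3 & t.1.1 < t.1.2].

(* In [seq E | a <- s, b <- t], a is the outer index and b the inner one, and
   [enum 'I_k] lists 0, ..., k - 1 in increasing order.  The value y = 0
   contributes no block, as then no x satisfies x < y. *)
Definition bose_BYXI (m : nat) : seq {set bose_point m} :=
  [seq bose_B1 x | x <- rev (enum 'I_m)] ++
  [seq B | y <- enum 'I_m,
           B <- [seq bose_B3 x y i | x <- [seq x : 'I_m <- enum 'I_m | x < y],
                                     i <- enum 'I_3]].

Definition bose_label (m : nat) (B : {set bose_point m}) : nat :=
  index B (bose_BYXI m).

Lemma mem_bose_BYXI m : bose_BYXI m =i bose_blocks m.
Proof.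
move=> B; rewrite mem_cat !inE; congr (_ || _).
  apply/mapP/imsetP => -[x _ ->]; exists x => //.
  by rewrite mem_rev mem_enum.
apply/allpairsPdep/imsetP.
  case=> y [B' [_ /allpairsP[[x i] /= [xy _ ->]] ->]].
  by exists (x, y, i) => //; move: xy; rewrite inE mem_filter => /andP[].
case=> -[[x y] i] /=; rewrite inE /= => xy ->.
exists y, (bose_B3 x y i); rewrite mem_enum; split=> //.
by apply/allpairsP; exists (x, i); rewrite mem_filter xy !mem_enum.
Qed.

Lemma in_bose_B1 m (x a : 'I_m) j : ((a, j) \in bose_B1 x) = (a == x).
Proof.
rewrite !inE !xpair_eqE -!andb_orr -orbA.
suff ->: [|| j == inord 0, j == inord 1 | j == inord 2] by rewrite andbT.
by case: j => -[|[|[|//]]] ?; rewrite -!val_eqE /= !inordK.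
Qed.

Lemma in_bose_B3 m (x y a : 'I_m) i j : ((a, j) \in bose_B3 x y i) =
  (j == i) && ((a == x) || (a == y)) || (j == ordS i) && (a == bose_op x y).
Proof.
by rewrite !inE !xpair_eqE -andb_orl andbC; congr (_ || _); rewrite andbC.
Qed.

Lemma ordS3_neq (i : 'I_3) : (ordS i == i = false) * (i == ordS i = false)
  * (ordS (ordS i) == i = false) * (ordS (ordS i) == ordS i = false).
Proof. by case: i => -[|[|[|//]]]. Qed.

Lemma bose_B3_inj m (x y x' y' : 'I_m) i i' : x < y -> x' < y' ->
  bose_B3 x y i = bose_B3 x' y' i' -> [/\ x = x', y = y' & i = i'].
Proof.
move=> xy xy' E.
have: (x, i) \in bose_B3 x' y' i' by rewrite -E in_bose_B3 !eqxx.
have: (y, i) \in bose_B3 x' y' i' by rewrite -E in_bose_B3 !eqxx orbT.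
rewrite !in_bose_B3; case: (eqVneq i i') => [<-|_] /=.
  rewrite ordS3_neq /= !orbF => /orP[] /eqP yE /orP[] /eqP xE; subst x y => //.
  - by rewrite ltnn in xy.
  - by have := ltn_trans xy xy'; rewrite ltnn.
  - by rewrite ltnn in xy.
by move=> /andP[_ /eqP yE] /andP[_ /eqP xE]; rewrite xE yE ltnn in xy.
Qed.

Lemma bose_B1_B3 m (x x' y' : 'I_m) i : bose_B1 x <> bose_B3 x' y' i.
Proof.
move=> /setP/(_ (x, ordS (ordS i))).
by rewrite in_bose_B1 in_bose_B3 eqxx !ordS3_neq.
Qed.

Lemma uniq_bose_BYXI m : uniq (bose_BYXI m).
Proof.
rewrite cat_uniq; apply/and3P; split.
- rewrite map_inj_uniq ?rev_uniq ?enum_uniq // => x x' /setP/(_ (x, ord0)).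
  by rewrite !in_bose_B1 eqxx => /esym/eqP.
- apply/hasPn => B /allpairsPdep[y [B' [_ /allpairsP[[x i] /= [_ _ ->]] ->]]].
  by apply/mapP => -[z _ /esym/bose_B1_B3].
apply: allpairs_uniq_dep; first exact: enum_uniq.
  move=> y _; apply: allpairs_uniq; [exact/filter_uniq/enum_uniq | exact: enum_uniq |].
  move=> [x i] [x' i'] /allpairsP[[? ?] /= [+ _ [-> ->]]].
  rewrite mem_filter => /andP[xy _].
  move=> /allpairsP[[? ?] /= [+ _ [-> ->]]].
  by rewrite mem_filter => /andP[xy' _] /(bose_B3_inj xy xy')[-> _ ->].
move=> [y B] [y' B'] /allpairsPdep[? [? [_ /allpairsP[[x i] /= [+ _ ->]]]]].
rewrite mem_filter => /andP[xy _] [-> ->].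
move=> /allpairsPdep[? [? [_ /allpairsP[[x' i'] /= [+ _ ->]]]]].
rewrite mem_filter => /andP[xy' _] [-> ->] /=.
by move=> /(bose_B3_inj xy xy')[-> -> ->].
Qed.

Lemma card_bose_blocks m : #|bose_blocks m| = (3 * m * (3 * m).-1) %/ 6.
Proof.
rewrite -(eq_card (@mem_bose_BYXI m)) (card_uniqP (uniq_bose_BYXI m)).
rewrite size_cat size_map size_rev size_enum_ord size_allpairs_dep sumnE big_map.
rewrite big_enum /=.
have -> : \sum_(y < m) size [seq bose_B3 x y i | x <- [seq x : 'I_m <- enum 'I_m | x < y],
    i <- enum 'I_3] = \sum_(y < m) y * 3.
  apply: eq_bigr => y _; rewrite size_allpairs size_enum_ord; congr (_ * _).
  rewrite -(size_map val) -(@filter_map _ _ val (fun k => k < y)) val_enum_ord.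
  rewrite -[X in iota 0 X](subnKC (ltnW (ltn_ord y))) iotaD filter_cat.
  rewrite (all_filterP _); last by apply/allP => k; rewrite mem_iota.
  rewrite (eq_in_filter (a2 := pred0)) ?filter_pred0 ?cats0 ?size_iota //.
  by move=> k; rewrite mem_iota add0n => /andP[yk _]; rewrite ltnNge yk.
rewrite -big_distrl /= -(big_mkord xpredT id) bin2_sum.
apply/esym; have := mul_bin_diag m 1; rewrite bin1.
case: m => [|m] //= mE.
rewrite (_ : _ * _ = (m.+1 + 'C(m.+1, 2) * 3) * 6) ?mulnK //.
by move: mE; generalize ('C(m.+1, 2)) => c mE; nia.
Qed.

Lemma bose_labelP m : block_labeling (bose_blocks m) (@bose_label m).
Proof.
split=> [B B'|B]; rewrite -!mem_bose_BYXI; last first.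
  rewrite -(eq_card (@mem_bose_BYXI m)) (card_uniqP (uniq_bose_BYXI m)).
  by rewrite index_mem.
by move=> sB sB' /(congr1 (nth B (bose_BYXI m))); rewrite !nth_index.
Qed.

(* Main.v *)
(* Write m = 2h+1 and s = 2a mod m.  The block B_{x,y,i} contains (a,i+1) iff
   x + y = 2a modulo m, that is, iff x + y is s or s + m, so the sum of labels
   at a point is a sum of four telescoping sums.  At (a,0) it is a cubic in a
   on each of the ranges a <= h and a > h; at (a,1) and (a,2) it is not smaller.  The
   minimum is at a = k, where k = m %/ 4: on a <= h the difference with the
   value at k is (a - k) times a quadratic with the sign of a - k, and for
   a > h it is, in k - 2 and a - h - 1, a polynomial with nonnegative
   coefficients. *)
Require Import Defs.
From mathcomp Require Import all_boot all_order all_algebra zify ring lra.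
Set Implicit Arguments.
Unset Strict Implicit.
Unset Printing Implicit Defensive.
Import Order.TTheory GRing.Theory Num.Theory.

(** * Sums of positions in a list *)

(** Unlike [index], this recursion splits along [++] and [flatten], so the nested enumeration
    [bose_BYXI] can be followed one loop at a time. *)
Fixpoint position_sum (T : Type) (P : pred T) (c : nat) (s : seq T) : nat :=
  if s is x :: s' then (if P x then c else 0) + position_sum P c.+1 s' else 0.

Lemma position_sum_cat (T : Type) (P : pred T) c (s t : seq T) :
  position_sum P c (s ++ t) = position_sum P c s + position_sum P (c + size s) t.
Proof.
by elim: s c => [|x s IH] c /=; rewrite ?addn0 // IH addnA addnS addSn.
Qed.

Lemma position_sum_index (T : eqType) (P : pred T) c (s : seq T) : uniq s ->
  \sum_(x <- s | P x) (c + index x s) = position_sum P c s.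
Proof.
elim: s c => [|x s IH] c /=; first by rewrite big_nil.
case/andP=> xs us; rewrite big_cons eqxx addn0 -IH //.
rewrite -[LHS]/(if P x then _ else _).
have -> : \sum_(y <- s | P y) (c + (if x == y then 0 else (index y s).+1))
    = \sum_(y <- s | P y) (c.+1 + index y s).
  rewrite [LHS]big_seq_cond [RHS]big_seq_cond; apply: eq_bigr => y /andP[ys _].
  by case: eqP ys xs => [->->|_ _ _] //; rewrite addnS addSn.
by case: (P x).
Qed.

(** The function [o] gives the position at which the segment [f i] starts. As the numbers [v i] are
    consecutive, the second hypothesis makes each segment start where the previous one ends. *)
Lemma position_sum_flatten (I T : Type) (P : pred T) (v : I -> nat)
    (f : I -> seq T) (o : nat -> nat) (s : seq I) k l :
  map v s = iota k l -> (forall i, o (v i).+1 = o (v i) + size (f i)) ->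
  position_sum P (o k) (flatten (map f s)) =
    \sum_(i <- s) position_sum P (o (v i)) (f i).
Proof.
move=> + oE; elim: s k l => [|i s IH] k [|l] //=; first by rewrite big_nil.
case=> vi sE; rewrite big_cons position_sum_cat vi -(IH k.+1 l) //.
by rewrite -[in o k.+1]vi oE vi.
Qed.

Lemma position_sum_map (I T : Type) (P : pred T) (v : I -> nat)
    (f : I -> T) c (s : seq I) k l :
  map v s = iota k l ->
  position_sum P (c + k) (map f s) =
    \sum_(i <- s) if P (f i) then c + v i else 0.
Proof.
move=> sE; have := position_sum_flatten P (f := fun i => [:: f i])
  (o := addn c) sE (fun i => etrans (addnS _ _) (esym (addn1 _))).
rewrite (_ : flatten _ = map f s) => [->|]; last by elim: {sE} s => //= i s ->.
by apply: eq_bigr => i _ /=; rewrite addn0.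
Qed.

(** * Labels in the order of [bose_BYXI] *)

(** The position of B_{x,y,i}: it is preceded by the m blocks B_x, by 3y' blocks for each y' < y,
    and by 3 blocks for each x' < x with the same y. *)
Definition bose_lab (m y x i : nat) : nat := m + 3 * 'C(y, 2) + 3 * x + i.

Lemma point_sum_BYXI m (p : bose_point m) :
  point_sum (bose_blocks m) (@bose_label m) p =
  (m.-1 - p.1) + \sum_(y < m) \sum_(x < m | x < y) \sum_(i < 3)
    if p \in bose_B3 x y i then bose_lab m y x i else 0.
Proof.
have -> : point_sum (bose_blocks m) (@bose_label m) p =
    position_sum (fun B : {set bose_point m} => p \in B) 0 (bose_BYXI m).
  rewrite -(position_sum_index _ _ (uniq_bose_BYXI m)) /point_sum.
  under [RHS]eq_bigr => B _ do rewrite add0n.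
  rewrite -!(big_filter _ (fun B : {set bose_point m} => p \in B)).
  rewrite -big_enum_cond -big_filter.
  apply: perm_big; apply: uniq_perm.
  - exact/filter_uniq/enum_uniq.
  - exact/filter_uniq/uniq_bose_BYXI.
  by move=> B; rewrite !mem_filter -enumT mem_enum mem_bose_BYXI andbT.
rewrite /bose_BYXI position_sum_cat; congr (_ + _).
  (* The blocks B_x come in decreasing order of x, so B_x has label m - 1 - x. *)
  have vE : [seq m.-1 - nat_of_ord x | x <- rev (enum 'I_m)] = iota 0 m.
    have -> : [seq m.-1 - nat_of_ord x | x <- rev (enum 'I_m)] =
        rev [seq m.-1 - k | k <- iota 0 m].
      by rewrite map_rev -val_enum_ord -map_comp.
    apply: (@eq_from_nth _ 0) => [|i]; rewrite size_rev size_map size_iota //.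
    by move=> im; rewrite nth_rev ?(nth_map 0) ?size_map ?size_iota ?nth_iota; lia.
  rewrite -[0]/(0 + 0) (position_sum_map _ _ _ vE).
  rewrite (perm_big _ (permEl (perm_rev _))) big_enum /= -big_mkcond.
  by case: p => a j; under eq_bigl do rewrite in_bose_B1; rewrite (big_pred1 a).
rewrite size_map size_rev size_enum_ord add0n.
have vE : map val (enum 'I_m) = iota 0 m by rewrite val_enum_ord.
have yE (y : 'I_m) : map val [seq x : 'I_m <- enum 'I_m | x < y] = iota 0 y.
  rewrite -(@filter_map _ _ val (fun k => k < y)) val_enum_ord.
  rewrite -[X in iota 0 X](subnKC (ltnW (ltn_ord y))) iotaD filter_cat.
  rewrite (all_filterP _); last by apply/allP => k; rewrite mem_iota.
  rewrite (eq_in_filter (a2 := pred0)) ?filter_pred0 ?cats0 //.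
  by move=> k; rewrite mem_iota add0n => /andP[yk _]; rewrite ltnNge yk.
rewrite -[X in position_sum _ X](addn0 m).
pose o k := m + 3 * 'C(k, 2).
rewrite -[X in position_sum _ X]/(o 0) (position_sum_flatten _ vE) => [|y].
  rewrite big_enum /=; apply: eq_bigr => y _.
  rewrite map_id -[X in position_sum _ X]/(o y).
  pose o' k := o y + 3 * k.
  rewrite -[X in position_sum _ X](addn0 (o y)) -[o y + 0]/(o' 0).
  rewrite (position_sum_flatten _ (yE y)) => [|x].
    rewrite big_filter big_enum_cond /=; apply: eq_bigr => x _.
    rewrite -[X in position_sum _ X]addn0 (@position_sum_map _ _ _ val _ _ _ _ 3).
      by rewrite big_enum.
    by rewrite val_enum_ord.
  by rewrite size_map size_enum_ord /o' mulnS; lia.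
rewrite map_id size_allpairs -(size_map val) yE size_iota size_enum_ord /o.
by rewrite binS bin1 [_ * 3]mulnC mulnDr addnA.
Qed.

(** * Point sums as sums over intervals *)

(** Either i = j and a is one of x, y (not both, as x < y), or i + 1 = j modulo 3, that is i = j +
    2, and a is the third point. *)
Lemma sum_bose_B3 m (a x y : 'I_m) (j : 'I_3) : x < y ->
  \sum_(i < 3) (if ((a, j) : bose_point m) \in bose_B3 x y i
                then bose_lab m y x i else 0) =
  (if x == a :> nat then bose_lab m y x j else 0)
  + (if y == a :> nat then bose_lab m y x j else 0)
  + (if a == bose_op x y then bose_lab m y x ((j + 2) %% 3) else 0).
Proof.
move=> xy; have jE : ordS (ordS (ordS j)) = j by case: j => -[|[|[|]]] // ?; apply: val_inj.
have jn : (j == ordS (ordS j)) = false by rewrite eq_sym ordS3_neq.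
have eE (z : 'I_m) : (z == a :> nat) = (a == z) by rewrite eq_sym.
rewrite !eE (bigD1 j) // (bigD1 (ordS (ordS j))) ?ordS3_neq //= big1 => [|i].
  rewrite addn0 !in_bose_B3 jE eqxx jn !ordS3_neq /= orbF.
  have -> : (j.+1 %% 3).+1 %% 3 = (j + 2) %% 3 by case: j {jE jn} => -[|[|[|]]].
  congr (_ + _).
  case: (eqVneq a x) => [ax|_] //=; case: (eqVneq a y) => // ay.
    by rewrite -ax -ay ltnn in xy.
  by rewrite addn0.
case/andP=> ij ij2; rewrite in_bose_B3 eq_sym (negPf ij) /=.
suff -> : (j == ordS i) = false by [].
apply: contra_neqF ij2 => /eqP->.
by case: i {ij} => -[|[|[|]]] // ?; apply: val_inj.
Qed.

(* [h + 1] is the inverse of 2 modulo [2 h + 1]. *)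
Lemma modn_half_eq h a b :
  (a == h.+1 * b %[mod h.*2.+1]) = (b == a.*2 %[mod h.*2.+1]).
Proof.
have half c : h.+1 * c.*2 = c %[mod h.*2.+1].
  have -> : h.+1 * c.*2 = c * h.*2.+1 + c by lia.
  by rewrite modnMDl.
apply/eqP/eqP => E; last by rewrite -modnMmr E modnMmr half.
rewrite -[LHS]half (_ : h.+1 * b.*2 = 2 * (h.+1 * b)); last by lia.
by rewrite -modnMmr -E modnMmr mul2n.
Qed.

(** Since x < y < m, the sum x + y is below 2m, so its congruence class leaves only two values. *)
Lemma bose_op_eq h (a x y : 'I_h.*2.+1) : x < y ->
  (a == bose_op x y) =
  (x + y == a.*2 %% h.*2.+1) || (x + y == a.*2 %% h.*2.+1 + h.*2.+1).
Proof.
move=> xy; rewrite -val_eqE /= -[in LHS](modn_small (ltn_ord a)).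
have -> : h.*2.+2 %/ 2 = h.+1 by rewrite -doubleS -muln2 mulnK.
rewrite modn_half_eq.
have : a.*2 %% h.*2.+1 < h.*2.+1 by rewrite ltn_mod.
have := ltn_ord y; move: (a.*2 %% _) => r ym rm.
case: (ltnP (x + y) h.*2.+1) => xym; first by rewrite modn_small //; lia.
have -> : (x + y) %% h.*2.+1 = x + y - h.*2.+1.
  by rewrite -[in LHS](subnK xym) modnDr modn_small; lia.
lia.
Qed.

Lemma sum_nat_if_eq n b (F : nat -> nat) :
  \sum_(x < n) (if x == b :> nat then F x else 0) = if b < n then F b else 0.
Proof.
by rewrite -big_mkcond big_ord1_eq.
Qed.

Lemma sum_ord_if n p q (F : nat -> nat) : q <= n ->
  \sum_(y < n) (if p <= y < q then F y else 0) = \sum_(p <= y < q) F y.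
Proof.
move=> qn; rewrite (big_nat_widenl _ 0) // (big_nat_widen _ _ _ _ _ qn) big_mkord.
by rewrite [RHS]big_mkcond.
Qed.

(** For given y only x = t - y can contribute, and 0 <= t - y < y means t/2 < y <= t. *)
Lemma sum_antidiagonal n t (F : nat -> nat -> nat) :
  \sum_(y < n) \sum_(x < y) (if x + y == t then F y x else 0) =
  \sum_(t./2.+1 <= y < minn n t.+1) F y (t - y).
Proof.
rewrite -(sum_ord_if _ _ (geq_minl _ _)); apply: eq_bigr => y _.
have -> : \sum_(x < y) (if x + y == t then F y x else 0) =
    \sum_(x < y) (if x == t - y :> nat then if y <= t then F y x else 0 else 0).
  apply: eq_bigr => x _; case: (leqP y t) => yt.
    by have -> : (x + y == t) = (x == t - y :> nat) by lia.
  by rewrite if_same (_ : (x + y == t) = false) //; lia.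
rewrite (sum_nat_if_eq _ _ (fun x => if y <= t then F y x else 0)).
have -> : (t./2.+1 <= y < minn n t.+1) = (y <= t) && (t - y < y).
  by have := ltn_ord y; lia.
by case: (y <= t); case: (_ < _).
Qed.

(** The first term is the label of B_a. The four sums run over the pairs with x = a, y = a, x + y =
    s and x + y = s + m. *)
Lemma point_sumE h (a : 'I_h.*2.+1) (j : 'I_3) :
  let m := h.*2.+1 in let s := a.*2 %% m in let i := (j + 2) %% 3 in
  point_sum (bose_blocks m) (@bose_label m) (a, j) =
  (h.*2 - a) + (\sum_(a.+1 <= y < m) bose_lab m y a j
                + \sum_(0 <= x < a) bose_lab m a x j
                + (\sum_(s./2.+1 <= y < s.+1) bose_lab m y (s - y) i
                + \sum_((s + m)./2.+1 <= y < m) bose_lab m y (s + m - y) i)).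
Proof.
move=> m s i; rewrite point_sum_BYXI /=; congr (_ + _).
under eq_bigr => y _ do under eq_bigr => x xy do rewrite (sum_bose_B3 _ _ xy) (bose_op_eq _ xy).
have sm : s < m by rewrite ltn_mod.
under eq_bigr => y _.
  rewrite (big_ord_narrow (ltnW (ltn_ord y))) /= !big_split /=.
  over.
rewrite [LHS]big_split /= [X in X + _]big_split /=; congr (_ + _ + _).
- rewrite -(@sum_ord_if m) //; apply: eq_bigr => y _.
  by rewrite (sum_nat_if_eq _ _ (fun x => bose_lab m y x j)) ltn_ord andbT.
- have -> : \sum_(0 <= x < a) bose_lab m a x j =
      if a < m then \sum_(x < a) bose_lab m a x j else 0.
    by rewrite ltn_ord big_mkord.
  rewrite -(sum_nat_if_eq _ _ (fun y => \sum_(x < y) bose_lab m y x j)).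
  by apply: eq_bigr => y _; case: eqP => // _; rewrite big1.
have := sum_antidiagonal m s (fun y x => bose_lab m y x i).
have := sum_antidiagonal m (s + m) (fun y x => bose_lab m y x i).
(* As s < m, the upper bound is m on the antidiagonal s + m and s + 1 on the antidiagonal s. *)
rewrite (minn_idPl _) ?(minn_idPr _) //; last by lia.
move=> <- <-; rewrite -big_split /=; apply: eq_bigr => y _.
rewrite -big_split /=; apply: eq_bigr => x _.
(* No pair lies on both antidiagonals, so the disjunction becomes a sum. *)
case: eqP => [->|_]; case: eqP; rewrite ?addn0 //; lia.
Qed.

(** * Closed forms of the point sums *)

Local Open Scope ring_scope.

Lemma natr_bin2 (R : realFieldType) (y : nat) : 'C(y, 2)%:R = y%:R * (y%:R - 1) / 2 :> R.
Proof.
elim: y => [|y IH]; first by rewrite !mul0r.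
by rewrite binS bin1 natrD IH; field.
Qed.

Lemma natr_sum_telescope (R : pzRingType) (F : nat -> nat) (G : nat -> R) p q :
  (p <= q)%N -> (forall y, (p <= y < q)%N -> (F y)%:R = G y.+1 - G y) ->
  (\sum_(p <= y < q) F y)%:R = G q - G p.
Proof.
by move=> pq FG; rewrite natr_sum -telescope_sumr //; apply: eq_big_nat.
Qed.

(** [G] is a discrete primitive: 3 C(y,2) is the forward difference of 3 C(y,3) = y(y-1)(y-2)/2. *)
Lemma sum_lab_fixed_x (R : realFieldType) m a j p q : (p <= q)%N ->
  let G (y : nat) : R :=
    (m + 3 * a + j)%:R * y%:R + y%:R * (y%:R - 1) * (y%:R - 2) / 2 in
  (\sum_(p <= y < q) bose_lab m y a j)%:R = G q - G p.
Proof.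
move=> pq G; apply: natr_sum_telescope => // y _.
by rewrite /bose_lab /G !natrD natr_bin2; field.
Qed.

Lemma sum_lab_fixed_y (R : realFieldType) m a j q :
  (\sum_(0 <= x < q) bose_lab m a x j)%:R =
  (m + j)%:R * q%:R + 3 / 2 * a%:R * (a%:R - 1) * q%:R
  + 3 / 2 * q%:R * (q%:R - 1) :> R.
Proof.
pose G (x : nat) : R := (m + j)%:R * x%:R + 3 / 2 * a%:R * (a%:R - 1) * x%:R
  + 3 / 2 * x%:R * (x%:R - 1).
rewrite (@natr_sum_telescope _ _ G) => // [|x _]; first by rewrite /G; field.
by rewrite /bose_lab /G !natrD natr_bin2; field.
Qed.

(** The additional term -3 C(y,2) is a primitive of the -3y coming from 3(t - y); the bound on q
    keeps the subtraction t - y exact. *)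
Lemma sum_lab_antidiagonal (R : realFieldType) m t i p q : (p <= q)%N -> (q <= t.+1)%N ->
  let G (y : nat) : R :=
    (m + 3 * t + i)%:R * y%:R + y%:R * (y%:R - 1) * (y%:R - 2) / 2
    - 3 / 2 * y%:R * (y%:R - 1) in
  (\sum_(p <= y < q) bose_lab m y (t - y) i)%:R = G q - G p.
Proof.
move=> pq qt G; apply: natr_sum_telescope => // y /andP[_ yq].
rewrite /bose_lab /G !natrD natr_bin2 natrB; last by lia.
by field.
Qed.

(* The sum at (a,0), for m = 2h+1, when a <= h ([low_sum]) and when a > h
   ([high_sum]). *)
Definition low_sum (R : realFieldType) (h a : R) : R :=
  15 / 2 * h ^+ 3 + 15 / 2 * h ^+ 2 + 7 * h
  - (3 / 2 * h ^+ 2 - 9 * h + 5) * a - (3 / 2 * h + 6) * a ^+ 2 + 4 * a ^+ 3.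

Definition high_sum (R : realFieldType) (h a : R) : R :=
  9 / 2 * h ^+ 3 - 3 * h ^+ 2 + 5 / 2 * h
  + (21 / 2 * h ^+ 2 + 24 * h - 1 / 2) * a
  - (21 / 2 * h + 21 / 2) * a ^+ 2 + 4 * a ^+ 3.

(** Here s = 2a. The index j occurs in 2h labels and (j + 2) mod 3 in h labels. [low_sum] already
    contains the 2h that these give for j = 0, hence the subtraction. *)
Lemma point_sum_low (R : realFieldType) h (a : 'I_h.*2.+1) (j : 'I_3) : (a <= h)%N ->
  (point_sum (bose_blocks h.*2.+1) (@bose_label h.*2.+1) (a, j))%:R =
  low_sum h%:R a%:R - 2 * h%:R
  + 2 * h%:R * j%:R + h%:R * ((j + 2) %% 3)%:R :> R.
Proof.
move=> ah; rewrite point_sumE modn_small; last by lia.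
have -> : a.*2./2.+1 = a.+1 by lia.
have -> : (a.*2 + h.*2.+1)./2.+1 = (a + h).+1 by lia.
move: ((j + 2) %% 3)%N => i; move: (nat_of_ord a) (nat_of_ord j) ah => {}a {}j ah.
rewrite !natrD natrB; last by lia.
rewrite sum_lab_fixed_x ?sum_lab_fixed_y ?sum_lab_antidiagonal; try lia.
by rewrite /low_sum -!addnn; field.
Qed.

Lemma point_sum_high (R : realFieldType) h (a : 'I_h.*2.+1) (j : 'I_3) : (h < a)%N ->
  (point_sum (bose_blocks h.*2.+1) (@bose_label h.*2.+1) (a, j))%:R =
  high_sum h%:R a%:R - 2 * h%:R
  + 2 * h%:R * j%:R + h%:R * ((j + 2) %% 3)%:R :> R.
Proof.
move=> ha; have am := ltn_ord a; rewrite point_sumE.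
(* With a = h + b + 1 one has 2a = m + (2b + 1), so s is the odd number 2b + 1. *)
have [b ab] : exists b, nat_of_ord a = (h + b.+1)%N by exists (a - h.+1)%N; lia.
have -> : (a.*2 %% h.*2.+1 = b.*2.+1)%N.
  have -> : (a.*2 = b.*2.+1 + h.*2.+1)%N by lia.
  by rewrite modnDr modn_small; lia.
have -> : b.*2.+1./2.+1 = b.+1 by lia.
have -> : (b.*2.+1 + h.*2.+1)./2.+1 = (b + h).+2 by lia.
move: ((j + 2) %% 3)%N => i; move: (nat_of_ord j) am => {}j; rewrite ab => am.
rewrite !natrD natrB; last by lia.
rewrite sum_lab_fixed_x ?sum_lab_fixed_y ?sum_lab_antidiagonal; try lia.
by rewrite /high_sum -!addnn; field.
Qed.

(** * Reduction of the minimum to level 0 *)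

(* At the point (a,j), [2 h j + h ((j + 2) mod 3)] is the contribution of the
   indices i to the labels; it is smallest, namely 2h, for j = 0 and j = 1. *)
Lemma residue_correction0 (R : realFieldType) (x y : R) :
  x - 2 * y + 2 * y * (@ord0 2)%:R + y * ((@ord0 2 + 2) %% 3)%:R <= x.
Proof. by rewrite mulr0n mulr0 addr0 (mulrC y) subrK. Qed.

Lemma residue_correction_ge (R : realFieldType) (x y : R) (j : 'I_3) : 0 <= y ->
  x <= x - 2 * y + 2 * y * j%:R + y * ((j + 2) %% 3)%:R.
Proof.
case: j => -[|[|[|]]] //= _ y0; rewrite -addrA -addrA lerDl.
- have -> : ((0 + 2) %% 3 = 2)%N by []. lra.
- have -> : ((1 + 2) %% 3 = 0)%N by []. lra.
- have -> : ((2 + 2) %% 3 = 1)%N by []. lra.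
Qed.

(** The point (a0,0) bounds the minimum from above. A minimizing point (a,j) bounds it from below,
    since its index correction is nonnegative and the cubics at a are compared by hypothesis. *)
Lemma natr_dual_min_sum (R : realFieldType) h a0 : (a0 <= h)%N ->
  (forall a, (a <= h)%N -> low_sum h%:R a0%:R <= low_sum h%:R a%:R :> R) ->
  (forall a, (h < a)%N -> low_sum h%:R a0%:R <= high_sum h%:R a%:R :> R) ->
  (dual_min_sum (bose_blocks h.*2.+1) (@bose_label h.*2.+1))%:R
    = low_sum h%:R a0%:R :> R.
Proof.
move=> a0h low high.
have a0m : (a0 < h.*2.+1)%N by lia.
pose p0 : bose_point h.*2.+1 := (Ordinal a0m, ord0).
have [[[a j] pE] ple] := dual_min_sumP (bose_blocks _) (@bose_label _) p0.
apply: le_anti; apply/andP; split.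
  apply: (@le_trans _ _ (point_sum (bose_blocks _) (@bose_label _) p0)%:R).
    by rewrite ler_nat.
  rewrite (@point_sum_low R h (Ordinal a0m) ord0 a0h).
  exact: residue_correction0.
have h0 : 0 <= h%:R :> R by rewrite ler0n.
rewrite pE; case: (leqP a h) => ah.
  by rewrite (point_sum_low _ _ ah); apply: le_trans (low _ ah) (residue_correction_ge _ _ h0).
by rewrite (point_sum_high _ _ ah); apply: le_trans (high _ ah) (residue_correction_ge _ _ h0).
Qed.

(** * Inequalities between the cubics *)

(** The slope of [low_sum] at a = k is 6k - 5 > 0, so over the reals values slightly below k would
    do better. For a < k the proof therefore uses that k - a is at least 1. *)
Lemma low_sum_min_even (R : realFieldType) k a : (1 < k)%N ->
  low_sum k.*2%:R k%:R <= low_sum k.*2%:R a%:R :> R.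
Proof.
move=> k1; have kR : 2 <= k%:R :> R by rewrite (ler_nat _ 2).
rewrite -muln2 natrM /low_sum -subr_ge0; case: (leqP k a) => [|ak].
  move=> /subnKC <-; rewrite natrD; move: (a - k)%N => d.
  have : 0 <= d%:R :> R by rewrite ler0n.
  move: (k%:R : R) (d%:R : R) kR {k1} => {}k {}d kR d0.
  rewrite (_ : _ - _ = d * (4 * d ^+ 2 + (9 * k - 6) * d + (6 * k - 5))); last by field.
  have := mulr_ge0 (_ : 0 <= 9 * k - 6) d0; have := sqr_ge0 d.
  by move=> d2 kd; apply: mulr_ge0 => //; have := kd ltac:(lra); lra.
have : 1 <= (k - a)%:R :> R by rewrite (ler_nat _ 1); lia.
have : (k - a)%:R <= k%:R :> R by rewrite ler_nat; lia.
have -> : a%:R = k%:R - (k - a)%:R :> R by rewrite natrB; [ring | lia].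
move: (k%:R : R) ((k - a)%:R : R) kR {k1 ak} => {}k e kR ek e1.
(* With e = k - a, every summand is nonnegative because 1 <= e <= k and k >= 2. *)
rewrite (_ : _ - _ = e * (4 * (e - 1) * (k - e) + (5 * k - 10) * (e - 1) + (3 * k - 5))); last by field.
have ke := mulr_ge0 (_ : 0 <= e - 1) (_ : 0 <= k - e).
have kk := mulr_ge0 (_ : 0 <= 5 * k - 10) (_ : 0 <= e - 1).
apply: mulr_ge0; first by lra.
by have := ke ltac:(lra) ltac:(lra); have := kk ltac:(lra) ltac:(lra); lra.
Qed.

(** Now the slope at a = k is 5/2 - 3k < 0, so the delicate side is a > k: the quadratic factor is
    expanded in d - 1, where d = a - k is at least 1. *)
Lemma low_sum_min_odd (R : realFieldType) k a : (1 < k)%N ->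
  low_sum k.*2.+1%:R k%:R <= low_sum k.*2.+1%:R a%:R :> R.
Proof.
move=> k1; have kR : 2 <= k%:R :> R by rewrite (ler_nat _ 2).
rewrite -muln2 mulrS natrM /low_sum -subr_ge0; case: (leqP k a) => [|ak].
  move=> /subnKC <-; rewrite natrD; move: (a - k)%N => d.
  case: d => [|d]; first by rewrite addr0 subrr.
  have : 1 <= d.+1%:R :> R by rewrite (ler_nat _ 1).
  move: (k%:R : R) (d.+1%:R : R) kR {k1} => {}k {}d kR d1.
  rewrite (_ : _ - _ = d * (4 * d ^+ 2 + (9 * k - 15 / 2) * (d - 1) + (6 * k - 5))); last by field.
  have := mulr_ge0 (_ : 0 <= 9 * k - 15 / 2) (_ : 0 <= d - 1); have := sqr_ge0 d.
  by move=> d2 kd; apply: mulr_ge0; [lra | have := kd ltac:(lra) ltac:(lra); lra].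
have : 1 <= (k - a)%:R :> R by rewrite (ler_nat _ 1); lia.
have : (k - a)%:R <= k%:R :> R by rewrite ler_nat; lia.
have -> : a%:R = k%:R - (k - a)%:R :> R by rewrite natrB; [ring | lia].
move: (k%:R : R) ((k - a)%:R : R) kR {k1 ak} => {}k e kR ek e1.
(* The last bracket is positive because e <= k and k >= 2. *)
rewrite (_ : _ - _ = e * (4 * (e - 1) * (k - e) + (5 * k - 10) * (e - 1) + (12 * k - 14 - 3 / 2 * (e - 1)))); last by field.
have ke := mulr_ge0 (_ : 0 <= e - 1) (_ : 0 <= k - e).
have kk := mulr_ge0 (_ : 0 <= 5 * k - 10) (_ : 0 <= e - 1).
apply: mulr_ge0; first by lra.
by have := ke ltac:(lra) ltac:(lra); have := kk ltac:(lra) ltac:(lra); lra.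
Qed.

Lemma low_high_sum_even (R : realFieldType) k a : (1 < k)%N -> (k.*2 < a)%N ->
  low_sum k.*2%:R k%:R <= high_sum k.*2%:R a%:R :> R.
Proof.
(* From here on [k] stands for the former k - 2, and [u] for a - h - 1 with h the former 2k. *)
move=> /subnKC <- /subnKC <-; move: (k - 2)%N (a - _)%N => {}k u.
rewrite -subr_ge0 -muln2 /low_sum /high_sum.
rewrite (_ : _ - _ = 13 * k%:R ^+ 3 + 84 * k%:R ^+ 2 + 184 * k%:R
  + 6 * k%:R ^+ 2 * u%:R + 3 * k%:R * u%:R ^+ 2 + 36 * k%:R * u%:R
  + 4 * u%:R ^+ 3 + 15 / 2 * u%:R ^+ 2 + 77 / 2 * u%:R + 129); last by field.
by rewrite ?(ler0n, exprn_ge0, invr_ge0, mulr_ge0, addr_ge0).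
Qed.

Lemma low_high_sum_odd (R : realFieldType) k a : (1 < k)%N -> (k.*2.+1 < a)%N ->
  low_sum k.*2.+1%:R k%:R <= high_sum k.*2.+1%:R a%:R :> R.
Proof.
move=> /subnKC <- /subnKC <-; move: (k - 2)%N (a - _)%N => {}k u.
rewrite -subr_ge0 -muln2 /low_sum /high_sum.
rewrite (_ : _ - _ = 13 * k%:R ^+ 3 + 207 / 2 * k%:R ^+ 2 + 557 / 2 * k%:R
  + 6 * k%:R ^+ 2 * u%:R + 3 * k%:R * u%:R ^+ 2 + 42 * k%:R * u%:R
  + 4 * u%:R ^+ 3 + 9 * u%:R ^+ 2 + 58 * u%:R + 245); last by field.
by rewrite ?(ler0n, exprn_ge0, invr_ge0, mulr_ge0, addr_ge0).
Qed.

Theorem theorem3 (n m : nat) (hn : (n = 3 %[mod 6])%N) (hnm : n = (3 * m)%N) :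
  ((n %/ 3 = 1 %[mod 4])%N -> (27 <= n)%N ->
    (dual_min_sum (bose_blocks m) (@bose_label m))%:R
      = 55 / 1728 * n%:R ^+ 3 + 1 / 192 * n%:R ^+ 2 - 9 / 64 * n%:R - 31 / 64
      :> rat) /\
  ((n %/ 3 = 3 %[mod 4])%N -> (33 <= n)%N ->
    (dual_min_sum (bose_blocks m) (@bose_label m))%:R
      = 55 / 1728 * n%:R ^+ 3 + 1 / 192 * n%:R ^+ 2 - 13 / 64 * n%:R + 13 / 64
      :> rat).
Proof.
have -> : (n %/ 3 = m)%N by rewrite hnm mulKn.
split=> m4 n_ge.
  (* m = 4k + 1 gives h = 2k, and n >= 27 gives k >= 2. *)
  have [k mE] : exists k, m = k.*2.*2.+1 by exists (m %/ 4)%N; lia.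
  have k1 : (1 < k)%N by lia.
  rewrite hnm mE (@natr_dual_min_sum _ k.*2 k) => [||a _|a]; first last.
  - exact: low_high_sum_even.
  - exact: low_sum_min_even.
  - by lia.
  by rewrite /low_sum -!muln2; field.
(* m = 4k + 3 gives h = 2k + 1, and n >= 33 gives k >= 2. *)
have [k mE] : exists k, m = k.*2.+1.*2.+1 by exists (m %/ 4)%N; lia.
have k1 : (1 < k)%N by lia.
rewrite hnm mE (@natr_dual_min_sum _ k.*2.+1 k) => [||a _|a]; first last.
- exact: low_high_sum_odd.
- exact: low_sum_min_odd.
- by lia.
by rewrite /low_sum -!muln2; field.
Qed.
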